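(* Let $\mathcal{G}=(\mathcal{V},\mathcal{E},\mathbf{W})$ be a connected signed weighted undirected graph with Laplacian $L\in\mathbb{R}^{n\times n}$, let $\mathcal{V}_a,\mathcal{V}_b\subset\mathcal{V}$ be any two non-empty disjoint sets, let $\mathcal{V}_c=\mathcal{V}\setminus(\mathcal{V}_a\cup\mathcal{V}_b)$ and $c=|\mathcal{V}_c|$. If $L$ is positive semi-definite with only one zero eigenvalue, then $r_{\mathrm{eff}}(L,\mathcal{V}_a,\mathcal{V}_b)>0$, $$r_{\mathrm{eff}}(L,\mathcal{V}_a,\mathcal{V}_b)=\min_{x\in\mathbb{R}^n}\left\{x^TL^{\dagger}x:\ \sum_{i\in\mathcal{V}_a}x_i=1,\ \sum_{i\in\mathcal{V}_b}x_i=-1,\ x_i=0\ \ \forall i\in\mathcal{V}_c\right\},$$ and $$r_{\mathrm{eff}}(L,\mathcal{V}_a,\mathcal{V}_b)=(\mathbf{e}_1-\mathbf{e}_2)^T\left(P_{ab}^TLP_{ab}\right)^{\dagger}(\mathbf{e}_1-\mathbf{e}_2),$$ where $\mathbf{e}_1,\mathbf{e}_2\in\mathbb{R}^{c+2}$ are the first two standard basis vectors and $P_{ab}=\begin{bmatrix}\mathbf{1}_{\mathcal{V}_a}&\mathbf{1}_{\mathcal{V}_b}&X_c\end{bmatrix}\in\mathbb{R}^{n\times(c+2)}$, with $\mathbf{1}_{\mathcal{V}_a},\mathbf{1}_{\mathcal{V}_b}\in\mathbb{R}^n$ the indicator vectors of $\mathcal{V}_a,\mathcal{V}_b$ and $X_c\in\mathbb{R}^{n\times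 c}$ the matrix whose columns are the standard basis vectors $\mathbf{e}_i\in\mathbb{R}^n$, $i\in\mathcal{V}_c$.
   Context: Graph: $\mathcal{G}=(\mathcal{V},\mathcal{E},\mathbf{W})$ is a simple undirected connected graph with finite node set $\mathcal{V}$, $n=|\mathcal{V}|$, edge set $\mathcal{E}$, $l=|\mathcal{E}|$; each edge $(i,j)$ carries a nonzero real weight $w_{ij}$, positive or negative, and $\mathbf{W}\in\mathbb{R}^{l\times l}$ is the diagonal matrix of edge weights. With the edges arbitrarily oriented, $\mathbf{E}\in\mathbb{R}^{n\times l}$ is the incidence matrix (column of an edge from $i$ to $j$: entry $1$ in row $i$, $-1$ in row $j$, $0$ elsewhere). The Laplacian is $L=\mathbf{E}\mathbf{W}\mathbf{E}^T$ (real symmetric with zero row sums). ''Positive semi-definite with only one zero eigenvalue'' means $L\succeq 0$ and $0$ is a simple eigenvalue. $A^{\dagger}$ denotes the Moore–Penrose inverse of $A$. Effective resistance/conductance: for non-empty disjoint $\mathcal{V}_a,\mathcal{V}_b\subset\mathcal{V}$ put $\mathcal{V}_c=\mathcal{V}\setminus(\mathcal{V}_a\cup\mathcal{V}_b)$, $a=|\mathcal{V}_a|$, $b=|\mathcal{V}_b|$, and let $L_{xy}$ be the submatrix of $L$ with rows indexed by $\mathcal{V}_x$ and columns by $\mathcal{V}_y$. When $L_{cc}$ is nonsingular (which is automatic if $L$ is positive semi-definite with only one zero eigenvalue), let $L/L_{cc}$ be the Schur complement $$L/L_{cc}=\begin{bmatrix}L_{aa}&L_{ab}\\L_{ab}^T&L_{bb}\end{bmatrix}-\begin{bmatrix}L_{ac}\\L_{bc}\end{bmatrix}L_{cc}^{-1}\begin{bmatrix}L_{ac}^T&L_{bc}^T\end{bmatrix},$$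 with $L/L_{cc}=L$ if $\mathcal{V}_c=\emptyset$. Then $g_{\mathrm{eff}}(L,\mathcal{V}_a,\mathcal{V}_b)=\mathbf{e}_{\mathcal{V}_a}^T(L/L_{cc})\mathbf{e}_{\mathcal{V}_a}$, where $\mathbf{e}_{\mathcal{V}_a}\in\mathbb{R}^{a+b}$ has entries $1$ on $\mathcal{V}_a$ and $0$ on $\mathcal{V}_b$, and $r_{\mathrm{eff}}(L,\mathcal{V}_a,\mathcal{V}_b)=g_{\mathrm{eff}}(L,\mathcal{V}_a,\mathcal{V}_b)^{-1}$ (with $r_{\mathrm{eff}}=\infty$ if $g_{\mathrm{eff}}=0$). *)

(* Defs.v *)
From HB Require Import structures.
From mathcomp Require Import all_boot all_order all_algebra.
From mathcomp Require Import classical_sets reals constructive_ereal.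

Set Implicit Arguments.
Unset Strict Implicit.
Unset Printing Implicit Defensive.

Import Order.TTheory GRing.Theory Num.Theory.
Local Open Scope ring_scope.

Definition penrose (R : realFieldType) (m n : nat)
    (A : 'M[R]_(m, n)) (B : 'M[R]_(n, m)) : bool :=
  [&& A *m B *m A == A, B *m A *m B == B,
      (A *m B)^T == A *m B & (B *m A)^T == B *m A].

Lemma row_free_gram_unit (R : realFieldType) (m n : nat) (A : 'M[R]_(m, n)) :
  row_free A -> A *m A^T \in unitmx.
Proof.
move=> fA; rewrite -row_free_unit; apply: inj_row_free => v vAA0.
have : ((v *m A) *m (v *m A)^T) 0 0 = 0.
  by rewrite trmx_mul mulmxA -(mulmxA v) vAA0 mul0mx mxE.
rewrite mxE => /eqP.
rewrite psumr_eq0 => [/allP sum0|j _]; last by rewrite [X in _ * X]mxE -expr2 sqr_ge0.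
apply: (row_free_inj fA); rewrite mul0mx.
apply/rowP => j; have := sum0 j (mem_index_enum j).
by rewrite /= [X in _ * X]mxE -expr2 sqrf_eq0 => /eqP ->; rewrite mxE.
Qed.

Lemma penrose_exists (R : realFieldType) (m n : nat) (A : 'M[R]_(m, n)) :
  exists B : 'M[R]_(n, m), penrose A B.
Proof.
have [r [C [D [eA uC uD]]]] : exists r (C : 'M[R]_(m, r)) (D : 'M[R]_(r, n)),
    [/\ A = C *m D, C^T *m C \in unitmx & D *m D^T \in unitmx].
  exists (\rank A), (col_base A), (row_base A); split.
  - by rewrite mulmx_base.
  - rewrite -{2}[col_base A]trmxK; apply: row_free_gram_unit.
    by rewrite /row_free mxrank_tr; exact: col_base_full.
  - exact/row_free_gram_unit/row_base_free.
pose B := D^T *m invmx (D *m D^T) *m (invmx (C^T *m C) *m C^T).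
have AB : A *m B = C *m invmx (C^T *m C) *m C^T.
  rewrite eA /B -!mulmxA; congr (C *m _).
  by rewrite !mulmxA mulmxV // mul1mx.
have BA : B *m A = D^T *m invmx (D *m D^T) *m D.
  rewrite eA /B -!mulmxA; congr (D^T *m (_ *m _)).
  by rewrite (mulmxA C^T) mulmxA mulVmx // mul1mx.
exists B; apply/and4P; split; apply/eqP.
- by rewrite AB eA -!mulmxA (mulmxA C^T) (mulmxA (invmx _)) mulVmx // mul1mx.
- rewrite BA /B -!mulmxA; congr (_ *m (_ *m _)).
  by rewrite (mulmxA D) (mulmxA (D *m D^T)) mulmxV // mul1mx.
- by rewrite AB !trmx_mul trmx_inv !trmx_mul !trmxK mulmxA.
- by rewrite BA !trmx_mul trmx_inv !trmx_mul !trmxK mulmxA.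
Qed.

Lemma penrose_unique (R : realFieldType) (m n : nat)
    (A : 'M[R]_(m, n)) (B C : 'M[R]_(n, m)) :
  penrose A B -> penrose A C -> B = C.
Proof.
case/and4P=> /eqP b1 /eqP b2 /eqP b3 /eqP b4.
case/and4P=> /eqP c1 /eqP c2 /eqP c3 /eqP c4.
have eAB : A *m B = A *m C.
  by rewrite -{1}c1 -[_ *m B]mulmxA -b3 -c3 -trmx_mul !mulmxA b1.
have eBA : B *m A = C *m A.
  by rewrite -{1}c1 !mulmxA -(mulmxA (B *m A)) -b4 -c4 -trmx_mul !mulmxA
     -(mulmxA C) -(mulmxA C) b1.
by rewrite -b2 eBA -mulmxA eAB mulmxA c2.
Qed.

(* The library's [pinvmx] only satisfies [A *m pinvmx A *m A = A]. *)
Definition mpinv (R : realFieldType) (m n : nat) (A : 'M[R]_(m, n)) :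
  'M[R]_(n, m) := xchoose (penrose_exists A).

Lemma mpinvP (R : realFieldType) (m n : nat) (A : 'M[R]_(m, n)) :
  penrose A (mpinv A).
Proof. exact: xchooseP. Qed.

Definition qform (R : realFieldType) (n : nat)
  (A : 'M[R]_n) (x : 'cV[R]_n) : R := (x^T *m A *m x) 0 0.

Definition psdmx (R : realFieldType) (n : nat) (A : 'M[R]_n) : Prop :=
  A^T = A /\ forall x : 'cV[R]_n, 0 <= qform A x.

Definition simple_eigenvalue (R : realFieldType) (n : nat)
  (A : 'M[R]_n) (a : R) : Prop := mup a (char_poly A) = 1%N.

(* Edge [k] is the pair {edge_tail k, edge_head k}; the choice of which
   endpoint is the tail is the arbitrary orientation.  Field [edge_inj]
   excludes parallel (and antiparallel) edges. *)
Record signed_graph (R : realFieldType) (n : nat) := SignedGraph {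
  nb_edges : nat;
  edge_tail : 'I_nb_edges -> 'I_n;
  edge_head : 'I_nb_edges -> 'I_n;
  edge_weight : 'I_nb_edges -> R;
  edge_irrefl : forall k, edge_tail k != edge_head k;
  edge_inj : injective (fun k => [set edge_tail k; edge_head k]);
  edge_weight_neq0 : forall k, edge_weight k != 0
}.

Definition adjacent (R : realFieldType) (n : nat) (G : signed_graph R n) :
    rel 'I_n :=
  fun i j => [exists k : 'I_(nb_edges G),
                [set edge_tail k; edge_head k] == [set i; j]].

Definition graph_connected (R : realFieldType) (n : nat) (G : signed_graph R n) :
    Prop := forall i j, connect (adjacent G) i j.

Definition incidence (R : realFieldType) (n : nat) (G : signed_graph R n) :
    'M[R]_(n, nb_edges G) :=
  \matrix_(i, k) ((i == edge_tail k)%:R - (i == edge_head k)%:R).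

Definition weightmx (R : realFieldType) (n : nat) (G : signed_graph R n) :
    'M[R]_(nb_edges G) := diag_mx (\row_k edge_weight k).

Definition laplacian (R : realFieldType) (n : nat) (G : signed_graph R n) :
    'M[R]_n := incidence G *m weightmx G *m (incidence G)^T.

(* Rows and columns are listed in the order of [enum X] and [enum Y]. *)
Definition submatrix (R : realFieldType) (n : nat) (A : 'M[R]_n)
    (X Y : {set 'I_n}) : 'M[R]_(#|X|, #|Y|) :=
  \matrix_(i < #|X|, j < #|Y|) A (enum_val i) (enum_val j).

(* When [Vc] is empty the subtracted product has inner dimension 0, hence
   vanishes.  When [Lcc] is singular, [invmx Lcc] is [Lcc]: the value is then
   meaningless. *)
Definition schur_ab (R : realFieldType) (n : nat) (L : 'M[R]_n)
    (Va Vb : {set 'I_n}) : 'M[R]_(#|Va| + #|Vb|) :=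
  let Vc := ~: (Va :|: Vb) in
  block_mx (submatrix L Va Va) (submatrix L Va Vb)
           (submatrix L Va Vb)^T (submatrix L Vb Vb)
  - col_mx (submatrix L Va Vc) (submatrix L Vb Vc)
    *m invmx (submatrix L Vc Vc)
    *m row_mx (submatrix L Va Vc)^T (submatrix L Vb Vc)^T.

Definition g_eff (R : realFieldType) (n : nat) (L : 'M[R]_n)
    (Va Vb : {set 'I_n}) : R :=
  qform (schur_ab L Va Vb)
        (col_mx (const_mx 1 : 'cV_#|Va|) (const_mx 0 : 'cV_#|Vb|)).

Definition r_eff (R : realFieldType) (n : nat) (L : 'M[R]_n)
    (Va Vb : {set 'I_n}) : \bar R :=
  if g_eff L Va Vb == 0 then +oo%E else ((g_eff L Va Vb)^-1)%:E.

Definition is_minimum (R : realFieldType) (S : set (\bar R)) (m : \bar R) :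
  Prop := S m /\ lbound S m.

Definition feasible (R : realFieldType) (n : nat) (Va Vb : {set 'I_n})
    (x : 'cV[R]_n) : Prop :=
  [/\ \sum_(i in Va) x i 0 = 1, \sum_(i in Vb) x i 0 = -1 &
      forall i, i \in ~: (Va :|: Vb) -> x i 0 = 0].

Definition indicator (R : realFieldType) (n : nat) (X : {set 'I_n}) :
  'cV[R]_n := \col_i (i \in X)%:R.

Definition selector (R : realFieldType) (n : nat) (X : {set 'I_n}) :
  'M[R]_(n, #|X|) := \matrix_(i < n, j < #|X|) (i == enum_val j)%:R.

(* [1 + (1 + c)] and [c.+2] are convertible. *)
Definition Pab (R : realFieldType) (n : nat) (Va Vb : {set 'I_n}) :
    'M[R]_(n, #|~: (Va :|: Vb)|.+2) :=
  row_mx (indicator R Va)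
         (row_mx (indicator R Vb) (selector R (~: (Va :|: Vb)))).

(* [e1 - e2], the first two standard basis vectors having indices 0 and 1. *)
Definition e1_sub_e2 (R : realFieldType) (c : nat) : 'cV[R]_c.+2 :=
  delta_mx 0 0 - delta_mx 1 0.

(* Main.v *)
Require Import Defs.
From mathcomp Require Import all_boot all_order all_algebra.
From mathcomp Require Import classical_sets reals constructive_ereal.
From mathcomp Require Import ring lra.
Set Implicit Arguments.
Unset Strict Implicit.
Unset Printing Implicit Defensive.

Import Order.TTheory GRing.Theory Num.Theory.
Local Open Scope ring_scope.

(** Read [L] as the response matrix of a resistor network: node potentials [v]
    give injected currents [L *m v].  Everything rests on one vector, the
    equilibrium [potential] that is 1 on [Va], 0 on [Vb], and at which the free
    nodes [Vc] (those outside [Va] and [Vb]) carry no current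
    ([current_free]).  The Schur complement
    is what elimination of the free nodes produces, so [g_eff] is the current
    that enters through [Va] ([g_eff_current]); as the currents sum to 0, the
    same current leaves through [Vb] ([sum_current_b]); and because the
    potential is 1 on [Va], 0 on [Vb] and sees no current elsewhere, [g_eff] is
    also the energy [qform L potential] ([g_eff_energy]).

    Simplicity of the eigenvalue 0 makes the kernel of [L] the line of constant
    vectors ([simple_eigenvalue0_kernel]).  Hence the block of [L] on the free
    nodes is invertible, and [g_eff] is positive, since the potential is not
    constant.

    Both formulas for [r_eff] follow from the identity that the quadratic form
    of the pseudoinverse of a symmetric [A] at [A *m w] equals that of [A] at
    [w] ([qform_mpinv_mulmx]).

    - Put [M := P^T L P] with [P = Pab].  The potential is [P *m y] for some
      [y], and [M *m y] collects the currents entering through [Va], [Vb] and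
      the free nodes, that is, [g_eff *: (e1 - e2)].  So the form of the
      pseudoinverse of [M] at [e1 - e2] is [g_eff^-2] times the energy [g_eff].

    - The currents [L *m potential], divided by [g_eff], are feasible and reach
      the value [g_eff^-1].  Conversely a feasible [x] sums to 0, hence
      [x = L *m w] for some [w]; it pairs to 1 with the potential, so
      Cauchy-Schwarz for [L] gives [1 <= g_eff * qform L w], and [qform L w] is
      the objective at [x]. *)

(** * Kernel at a simple zero eigenvalue *)

(** The algebraic multiplicity of the eigenvalue 0 is at least the geometric
    one.  Left multiplication by an invertible constant matrix turns [A] into a
    matrix whose last [n - \rank A] rows vanish; the same multiplication turns
    the matching rows of ['X - A] into multiples of ['X]. *)
Lemma dvdp_char_poly_corank (F : fieldType) (n : nat) (A : 'M[F]_n) :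
  'X ^+ (n - \rank A) %| char_poly A.
Proof.
set r := \rank A; pose U := invmx (col_ebase A); pose D := row_ebase A.
have UA : U *m A = pid_mx r *m D.
  by rewrite /U -{2}(mulmx_ebase A) !mulmxA mulVmx ?col_ebase_unit ?mul1mx.
(* [N] is what remains of [U *m ('X - A)] once the factor ['X] is taken out of
   the rows of index at least [r]. *)
pose d := \row_(i < n) (if (i < r)%N then 1 else 'X) : 'rV[{poly F}]_n.
pose Ux := map_mx polyC U.
have [N fac] : exists N, Ux *m char_poly_mx A = diag_mx d *m N.
  exists (\matrix_(i, j) if (i < r)%N
            then (Ux *m char_poly_mx A) i j else (U i j)%:P).
  apply/matrixP=> i j; rewrite mul_diag_mx !mxE.
  case: ifP => ir; first by rewrite mul1r.
  have -> : \sum_k Ux i k * char_poly_mx A k j = (Ux *m char_poly_mx A) i j.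
    by rewrite mxE.
  rewrite /char_poly_mx mulmxBr mul_mx_scalar -map_mxM UA !mxE.
  rewrite big1 ?subr0 // => k _.
  by rewrite mxE ir andbF mul0r.
have dX : \prod_i d 0 i = 'X ^+ (n - r).
  under eq_bigr do rewrite mxE.
  rewrite -(big_mkord xpredT (fun i => if (i < r)%N then 1 else 'X : {poly F})).
  rewrite (@big_cat_nat _ _ _ r) ?rank_leq_row //= big_nat_cond big1 ?mul1r.
    rewrite -prodr_const_nat; apply: eq_big_nat => i /andP[ri _].
    by rewrite ltnNge ri.
  by move=> i /andP[/andP[_ ->]].
move/(congr1 determinant): fac; rewrite !det_mulmx det_diag dX det_map_mx.
rewrite mul_polyC => fac.
have U0 : \det U != 0 by rewrite det_inv invr_eq0 -unitfE -unitmxE col_ebase_unit.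
by rewrite -(dvdpZr _ _ U0) fac dvdp_mulr.
Qed.

Lemma simple_eigenvalue0_kernel (R : realFieldType) (n : nat) (L : 'M[R]_n)
    (u v : 'cV[R]_n) :
  simple_eigenvalue L 0 -> L^T = L -> u != 0 ->
  L *m u = 0 -> L *m v = 0 -> exists c, v = c *: u.
Proof.
move=> sL sym u0 Lu Lv.
have corank : (\rank (kermx L) <= 1)%N.
  rewrite mxrank_ker -sL mup_geq ?monic_neq0 ?char_poly_monic //.
  by rewrite subr0 dvdp_char_poly_corank.
have inker (w : 'cV_n) : L *m w = 0 -> (w^T <= kermx L)%MS.
  by move=> Lw; apply/sub_kermxP; rewrite -sym -trmx_mul Lw trmx0.
have uker : (kermx L <= u^T)%MS.
  rewrite -(mxrank_leqif_sup (inker _ Lu)).2 eqn_leq mxrankS ?inker //=.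
  by rewrite (leq_trans corank) // rank_rV -trmx0 (inj_eq trmx_inj) u0.
have /sub_rVP[c vc] := submx_trans (inker _ Lv) uker.
by exists c; apply: trmx_inj; rewrite vc linearZ.
Qed.

(** * Positive semidefinite forms and pseudoinverses *)

(** The form is nonnegative at all [s *: x + t *: y]; two choices of [s] and
    [t] suffice. *)
Lemma psd_cauchy_schwarz (R : realFieldType) (n : nat) (A : 'M[R]_n)
    (x y : 'cV[R]_n) :
  psdmx A -> ((x^T *m A *m y) 0 0) ^+ 2 <= qform A x * qform A y.
Proof.
case=> sym psd.
have yx : (y^T *m A *m x) 0 0 = (x^T *m A *m y) 0 0.
  by rewrite -[in LHS](trmxK x) -[in LHS]sym -!trmx_mul mulmxA mxE.
have comb s t : 0 <= s ^+ 2 * qform A x + 2 * s * t * (x^T *m A *m y) 0 0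
                     + t ^+ 2 * qform A y.
  have -> : s ^+ 2 * qform A x + 2 * s * t * (x^T *m A *m y) 0 0
      + t ^+ 2 * qform A y = qform A (s *: x + t *: y).
    have E : (s *: x + t *: y)^T *m A *m (s *: x + t *: y)
        = s *: (s *: (x^T *m A *m x) + t *: (x^T *m A *m y))
        + t *: (s *: (y^T *m A *m x) + t *: (y^T *m A *m y)).
      rewrite [_^T]linearD /= ![(_ *: _)^T]linearZ /= !mulmxDl -!scalemxAl.
      by rewrite !mulmxDr -!scalemxAr.
    rewrite {3}/qform E; have Z (M N P Q : 'M[R]_1) :
        (s *: (s *: M + t *: N) + t *: (s *: P + t *: Q)) 0 0
        = s * (s * M 0 0 + t * N 0 0) + t * (s * P 0 0 + t * Q 0 0).
      by rewrite !mxE.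
    by rewrite Z yx /qform; ring.
  exact: psd.
have := psd x; have := psd y.
(* If [qform A y] is positive, the first choice divides to the claim; if it is
   0, the second one forces the mixed term to vanish. *)
have := comb (qform A y) (- ((x^T *m A *m y) 0 0)).
have := comb ((x^T *m A *m y) 0 0) (- qform A x - 1).
move: (qform A x) (qform A y) ((x^T *m A *m y) 0 0) => a c b.
move=> {comb psd sym yx x y} h1 h2 c0 a0; rewrite leNgt; apply/negP => abs.
have c00 : c = 0 by nra.
rewrite c00 in h1 abs.
nra.
Qed.

Lemma psd_qform_eq0 (R : realFieldType) (n : nat) (A : 'M[R]_n) (x : 'cV[R]_n) :
  psdmx A -> qform A x = 0 -> A *m x = 0.
Proof.
move=> psdA qx; apply: trmx_inj; rewrite trmx_mul psdA.1 trmx0.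
apply/rowP => i; rewrite [RHS]mxE.
have := psd_cauchy_schwarz x (delta_mx i 0) psdA.
rewrite qx mul0r -colE !mxE => le0.
by apply/eqP; rewrite -sqrf_eq0 eq_le le0 sqr_ge0.
Qed.

Lemma qformZ (R : realFieldType) (n : nat) (A : 'M[R]_n) (c : R) (x : 'cV[R]_n) :
  qform A (c *: x) = c ^+ 2 * qform A x.
Proof.
rewrite /qform [_^T]linearZ /= -scalemxAr -!scalemxAl !mxE.
by rewrite mulrA expr2.
Qed.

Lemma gram_eq0 (R : realFieldType) (n : nat) (x : 'cV[R]_n) :
  x^T *m x = 0 -> x = 0.
Proof.
move/matrixP/(_ 0 0); rewrite !mxE => /eqP.
rewrite psumr_eq0 => [/allP x0|i _]; last by rewrite mxE -expr2 sqr_ge0.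
apply/colP => i; have := x0 i (mem_index_enum i).
by rewrite !mxE /= -expr2 sqrf_eq0 => /eqP.
Qed.

Lemma mulmx_mpinvK (R : realFieldType) (m n : nat) (A : 'M[R]_(m, n)) :
  A *m mpinv A *m A = A.
Proof. by case/and4P: (mpinvP A) => /eqP. Qed.

(** On the range of a symmetric matrix, its pseudoinverse defines the dual
    quadratic form. *)
Lemma qform_mpinv_mulmx (R : realFieldType) (n : nat) (A : 'M[R]_n)
    (w : 'cV[R]_n) :
  A^T = A -> qform (mpinv A) (A *m w) = qform A w.
Proof.
move=> sym; rewrite /qform trmx_mul sym -[in RHS](mulmx_mpinvK A).
by rewrite !mulmxA.
Qed.

(** The range of a symmetric matrix is the orthogonal complement of its kernel:
    the defect [x - A *m (mpinv A *m x)] lies in the kernel, so it is orthogonal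
    both to [x] and to the range, hence to itself. *)
Lemma mulmx_mpinv_id (R : realFieldType) (n : nat) (A : 'M[R]_n)
    (x : 'cV[R]_n) :
  A^T = A -> (forall v : 'cV_n, A *m v = 0 -> v^T *m x = 0) ->
  A *m (mpinv A *m x) = x.
Proof.
move=> sym orth; have /and4P[_ _ /eqP symAB _] := mpinvP A.
pose u := x - A *m (mpinv A *m x).
have Au : A *m u = 0.
  rewrite mulmxBr !mulmxA; apply/eqP; rewrite subr_eq0; apply/eqP.
  congr (_ *m _).
  by rewrite -[LHS]sym -[in LHS](mulmx_mpinvK A) trmx_mul sym symAB mulmxA.
have : u = 0; last by move/eqP; rewrite subr_eq0 => /eqP.
apply: gram_eq0; rewrite {2}/u mulmxBr (orth _ Au) sub0r.
have uA : u^T *m A = 0 by apply: trmx_inj; rewrite trmx_mul trmxK sym Au trmx0.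
by rewrite !mulmxA uA !mul0mx oppr0.
Qed.

(** * Restriction to a set of nodes *)

Section Selectors.
Variables (R : realFieldType) (n : nat).
Implicit Types (L : 'M[R]_n) (X Y : {set 'I_n}).

Lemma selectorE X : selector R X = colsub enum_val 1%:M.
Proof. by apply/matrixP => i j; rewrite !mxE. Qed.

Lemma submatrixE L X Y :
  submatrix L X Y = (selector R X)^T *m L *m selector R Y.
Proof.
rewrite !selectorE mulmx_colsub mulmx1 trmx_mxsub trmx1 mul_rowsub_mx mul1mx.
by apply/matrixP => i j; rewrite !mxE.
Qed.

Lemma tr_selector_mul X (x : 'cV[R]_n) :
  (selector R X)^T *m x = \col_j x (enum_val j) 0.
Proof.
rewrite selectorE trmx_mxsub trmx1 mul_rowsub_mx mul1mx.
by apply/colP=> j; rewrite !mxE.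
Qed.

Lemma selector_mul_out X (z : 'cV[R]_#|X|) i :
  i \notin X -> (selector R X *m z) i 0 = 0.
Proof.
move=> iX; rewrite mxE big1 // => j _; rewrite mxE.
by case: eqP iX => [->|]; rewrite ?enum_valP ?mul0r.
Qed.

Lemma selector_mul_inj X : injective (mulmx (selector R X) : 'cV_#|X| -> 'cV_n).
Proof.
move=> z1 z2 /(congr1 (mulmx (selector R X)^T)).
rewrite !tr_selector_mul => /colP eqz; apply/colP => j.
have val z : (selector R X *m z) (enum_val j) 0 = z j 0.
  rewrite mxE (bigD1 j) //= mxE eqxx mul1r big1 ?addr0 // => k kj.
  by rewrite mxE (inj_eq enum_val_inj) eq_sym (negPf kj) mul0r.
by have := eqz j; rewrite mxE val [X in _ = X -> _]mxE val.
Qed.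

Lemma selector_mul1 X : selector R X *m const_mx 1 = indicator R X.
Proof.
apply/colP=> i; rewrite [RHS]mxE; case: (boolP (i \in X)) => iX; last first.
  exact: selector_mul_out.
rewrite mxE (bigD1 (enum_rank_in iX i)) //= !mxE enum_rankK_in // eqxx mul1r.
rewrite big1 ?addr0 // => j ji; rewrite !mxE mulr1.
case: (i =P enum_val j) ji => // eij.
by rewrite [X in enum_rank_in _ X]eij enum_valK_in eqxx.
Qed.

Lemma tr_indicator_mul X (x : 'cV[R]_n) :
  ((indicator R X)^T *m x) 0 0 = \sum_(i in X) x i 0.
Proof.
rewrite mxE [RHS]big_mkcond; apply: eq_bigr => i _; rewrite !mxE.
by case: (i \in X); rewrite ?mul1r ?mul0r.
Qed.

End Selectors.

(** A vector killed by the block on [X], extended by 0, has zero energy, so it is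
    constant; it vanishes at [i]. *)
Lemma submatrix_unit (R : realFieldType) (n : nat) (L : 'M[R]_n)
    (X : {set 'I_n}) (i : 'I_n) :
  psdmx L ->
  (forall v : 'cV_n, L *m v = 0 -> exists c, v = c *: const_mx 1) ->
  i \notin X -> submatrix L X X \in unitmx.
Proof.
move=> psdL kerL iX; rewrite -row_free_unit; apply: inj_row_free => z zL.
have Sz0 : selector R X *m z^T = 0.
  have /kerL[c Szc] : L *m (selector R X *m z^T) = 0.
    apply: psd_qform_eq0 => //; rewrite /qform trmx_mul trmxK !mulmxA.
    rewrite -2!(mulmxA z) -submatrixE zL.
    by rewrite mul0mx mxE.
  have := selector_mul_out z^T iX; rewrite Szc !mxE mulr1 => ->.
  by rewrite scale0r.
apply: trmx_inj; apply: (@selector_mul_inj R n X); rewrite Sz0 trmx0.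
by rewrite mulmx0.
Qed.

(** * The equilibrium potential *)

Section Potential.
Variables (R : realFieldType) (n : nat) (L : 'M[R]_n) (Va Vb : {set 'I_n}).
Local Notation Vc := (~: (Va :|: Vb)).
Local Notation Sc := (selector R Vc).

(** The solution [z] of [Lcc z = - Lca 1], which says that the free nodes carry
    no current when [Va] is held at potential 1 and [Vb] at 0. *)
Definition potential_free : 'cV[R]_#|Vc| :=
  - (invmx (submatrix L Vc Vc) *m (Sc^T *m (L *m indicator R Va))).

Definition potential : 'cV[R]_n := indicator R Va + Sc *m potential_free.

Lemma potential_in_a i : i \in Va -> potential i 0 = 1.
Proof.
move=> ia; rewrite mxE selector_mul_out ?addr0; last first.
  by rewrite !inE ia.
by rewrite mxE ia.
Qed.

Lemma potential_in_b i : [disjoint Va & Vb] -> i \in Vb -> potential i 0 = 0.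
Proof.
move=> dab ib; rewrite mxE selector_mul_out ?addr0; last first.
  by rewrite !inE ib orbT.
by rewrite mxE (disjointFl dab ib).
Qed.

Lemma Pab_mul_potential :
  Pab R Va Vb *m (col_mx (const_mx 1 : 'cV_1)
                    (col_mx (0 : 'cV_1) potential_free) : 'cV_(#|Vc|.+2))
  = potential.
Proof.
apply: etrans (@mul_row_col R n 1 (1 + #|Vc|) 1 _ _ _ _) _.
rewrite mul_row_col mulmx0 add0r; congr (_ + _).
by apply/colP=> i; rewrite mxE big_ord1 !mxE mulr1.
Qed.

(** With [S] the selector of [Va] and [Vb], the Schur complement is
    [S^T (L - L Sc Lcc^-1 Sc^T L) S]; the matrix in parentheses sends the
    indicator of [Va] to the currents of the potential. *)
Lemma g_eff_current :
  L^T = L -> g_eff L Va Vb = \sum_(i in Va) (L *m potential) i 0.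
Proof.
move=> sym; rewrite -tr_indicator_mul /g_eff /qform.
set e := col_mx _ _; pose S := row_mx (selector R Va) (selector R Vb).
have trsub X Y : (submatrix L X Y)^T = submatrix L Y X.
  by rewrite !submatrixE !trmx_mul trmxK sym mulmxA.
have Se : S *m e = indicator R Va.
  have cst0 : const_mx 0 = 0 :> 'cV[R]_#|Vb| by [].
  by rewrite mul_row_col selector_mul1 cst0 mulmx0 addr0.
have -> : schur_ab L Va Vb = S^T *m L *m S
    - S^T *m L *m Sc *m invmx (submatrix L Vc Vc) *m (Sc^T *m L *m S).
  rewrite /schur_ab /block_mx !trsub /S tr_row_mx !mul_col_mx !mul_mx_row.
  by rewrite !submatrixE.
rewrite mulmxBr mulmxBl -Se trmx_mul /potential /potential_free -Se.
by rewrite !(mulmxN, mulmxDr) !mulmxA.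
Qed.

Hypotheses (psdL : psdmx L) (L1 : L *m (const_mx 1 : 'cV_n) = 0).
Hypothesis kerL : forall v : 'cV_n, L *m v = 0 -> exists c, v = c *: const_mx 1.
Hypotheses (a_neq0 : Va != finset.set0) (b_neq0 : Vb != finset.set0).
Hypothesis dab : [disjoint Va & Vb].

Lemma no_current_free : Sc^T *m (L *m potential) = 0.
Proof.
have /set0Pn[i ia] := a_neq0.
have uLcc : submatrix L Vc Vc \in unitmx.
  by apply: (submatrix_unit (i := i) psdL kerL); rewrite !inE ia.
rewrite /potential !mulmxDr /potential_free !mulmxN.
have E (z : 'cV_#|Vc|) : Sc^T *m (L *m (Sc *m z)) = submatrix L Vc Vc *m z.
  by rewrite submatrixE !mulmxA.
by rewrite E mulKVmx // subrr.
Qed.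

Lemma current_free i : i \in Vc -> (L *m potential) i 0 = 0.
Proof.
move=> ic; have /colP/(_ (enum_rank_in ic i)) := no_current_free.
by rewrite tr_selector_mul mxE enum_rankK_in // => ->; rewrite mxE.
Qed.

Lemma g_eff_energy : g_eff L Va Vb = qform L potential.
Proof.
rewrite g_eff_current ?psdL.1 // -tr_indicator_mul /qform -mulmxA.
rewrite {2}/potential [(_ + _)^T]linearD /= mulmxDl trmx_mul -mulmxA.
rewrite no_current_free.
by rewrite mulmx0 addr0.
Qed.

Lemma sum_current_b : \sum_(i in Vb) (L *m potential) i 0 = - g_eff L Va Vb.
Proof.
have tot : \sum_i (L *m potential) i 0 = 0.
  transitivity (((const_mx 1 : 'cV_n)^T *m (L *m potential)) 0 0).
    by rewrite mxE; apply: eq_bigr => i _; rewrite !mxE mul1r.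
  by rewrite mulmxA -{1}psdL.1 -trmx_mul L1 trmx0 mul0mx mxE.
move: tot; rewrite (bigID (mem [predU Va & Vb])) /= [X in _ + X]big1 => [|i iab].
  rewrite addr0 bigU //= -g_eff_current ?psdL.1 //.
  by rewrite addrC => /eqP; rewrite addr_eq0 => /eqP.
by apply: current_free; rewrite !inE; rewrite !inE in iab.
Qed.

(** A potential of zero energy would be constant, but it takes both values 1
    and 0. *)
Lemma g_eff_gt0 : 0 < g_eff L Va Vb.
Proof.
rewrite lt0r g_eff_energy psdL.2 andbT; apply/eqP => q0.
have [c vc] := kerL (psd_qform_eq0 psdL q0).
have /set0Pn[i ia] := a_neq0; have /set0Pn[j jb] := b_neq0.
have := potential_in_a ia; have := potential_in_b dab jb.
by rewrite vc !mxE => -> /esym/eqP; rewrite oner_eq0.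
Qed.

(** Transposed, [Pab] adds up the currents over [Va], over [Vb], and reads them
    off at the free nodes. *)
Lemma Pab_current :
  (Pab R Va Vb)^T *m (L *m potential) = g_eff L Va Vb *: e1_sub_e2 R #|Vc|.
Proof.
have -> : (Pab R Va Vb)^T = col_mx (indicator R Va)^T
    (col_mx (indicator R Vb)^T Sc^T) :> 'M_(1 + (1 + #|Vc|), n).
  by apply: etrans (@tr_row_mx R n 1 (1 + #|Vc|) _ _) _; rewrite tr_row_mx.
apply: etrans (@mul_col_mx R 1 (1 + #|Vc|) n 1 _ _ _) _.
rewrite mul_col_mx no_current_free.
have -> : (indicator R Va)^T *m (L *m potential) = (g_eff L Va Vb)%:M.
  by rewrite [LHS]mx11_scalar tr_indicator_mul g_eff_current ?psdL.1.
have -> : (indicator R Vb)^T *m (L *m potential) = (- g_eff L Va Vb)%:M.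
  by rewrite [LHS]mx11_scalar tr_indicator_mul sum_current_b.
apply/colP => i; rewrite !mxE.
case: splitP => [j | j] ij; rewrite !mxE.
  rewrite ord1 in ij *.
  have -> : i = 0 by apply: val_inj.
  by rewrite /= subr0 mulr1.
have -> : (i == 0) = false by rewrite -val_eqE /= ij.
case: splitP => [k | k] jk; rewrite !mxE.
  rewrite ord1 in jk *.
  have -> : i = 1 by apply: val_inj; rewrite /= ij jk.
  by rewrite sub0r mulrN mulr1.
have -> : (i == 1) = false by rewrite -val_eqE /= ij jk.
by rewrite subrr mulr0.
Qed.

Lemma feasible_current :
  feasible Va Vb ((g_eff L Va Vb)^-1 *: (L *m potential)).
Proof.
have g0 := lt0r_neq0 g_eff_gt0; split.
- under eq_bigr do rewrite mxE.
  by rewrite -mulr_sumr -g_eff_current ?psdL.1 // mulVf.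
- under eq_bigr do rewrite mxE.
  by rewrite -mulr_sumr sum_current_b mulrN mulVf.
by move=> i ic; rewrite mxE current_free // mulr0.
Qed.

Lemma qform_mpinv_current :
  qform (mpinv L) ((g_eff L Va Vb)^-1 *: (L *m potential))
  = (g_eff L Va Vb)^-1.
Proof.
have g0 := lt0r_neq0 g_eff_gt0.
rewrite qformZ qform_mpinv_mulmx ?psdL.1 // -g_eff_energy.
by rewrite expr2 -mulrA mulVf // mulr1.
Qed.

Lemma sum_feasible (x : 'cV[R]_n) : feasible Va Vb x -> \sum_i x i 0 = 0.
Proof.
case=> xa xb xc; rewrite (bigID (mem [predU Va & Vb])) /= [X in _ + X]big1.
  by rewrite addr0 bigU //= xa xb subrr.
by move=> i iab; apply: xc; rewrite !inE; rewrite !inE in iab.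
Qed.

Lemma potential_feasible (x : 'cV[R]_n) :
  feasible Va Vb x -> (potential^T *m x) 0 0 = 1.
Proof.
case=> xa _ xc; rewrite mxE -xa [RHS]big_mkcond; apply: eq_bigr => i _.
rewrite mxE; case: ifP => ia; first by rewrite potential_in_a // mul1r.
case: (boolP (i \in Vb)) => ib; first by rewrite potential_in_b ?mul0r.
by rewrite xc ?mulr0 // !inE ia (negPf ib).
Qed.

(** Lower bound of the minimization, by Cauchy-Schwarz between the potential and
    a vector [w] with [L *m w = x]. *)
Lemma qform_mpinv_feasible_ge (x : 'cV[R]_n) :
  feasible Va Vb x -> (g_eff L Va Vb)^-1 <= qform (mpinv L) x.
Proof.
move=> fx; pose w := mpinv L *m x.
have Lw : L *m w = x.
  apply: mulmx_mpinv_id psdL.1 _ => v /kerL[c ->].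
  apply/matrixP=> i j; rewrite !ord1 [_^T]linearZ /= -scalemxAl !mxE.
  under eq_bigr do rewrite !mxE mul1r.
  by rewrite (sum_feasible fx) mulr0.
have := psd_cauchy_schwarz potential w psdL.
rewrite -mulmxA Lw potential_feasible // expr1n -g_eff_energy.
rewrite -Lw qform_mpinv_mulmx ?psdL.1 // => cs.
by rewrite -[X in X <= _]mul1r ler_pdivrMr ?g_eff_gt0 // mulrC.
Qed.

Lemma qform_mpinv_Pab :
  qform (mpinv ((Pab R Va Vb)^T *m L *m Pab R Va Vb)) (e1_sub_e2 R #|Vc|)
  = (g_eff L Va Vb)^-1.
Proof.
have g0 := lt0r_neq0 g_eff_gt0.
set M := _ *m L *m _.
set y := (col_mx (const_mx 1 : 'cV_1)
                 (col_mx (0 : 'cV_1) potential_free) : 'cV_(#|Vc|.+2)).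
have My : M *m y = g_eff L Va Vb *: e1_sub_e2 R #|Vc|.
  by rewrite -mulmxA Pab_mul_potential -mulmxA Pab_current.
have -> : e1_sub_e2 R #|Vc| = M *m ((g_eff L Va Vb)^-1 *: y).
  by rewrite -scalemxAr My scalerA mulVf // scale1r.
rewrite qform_mpinv_mulmx; last by rewrite !trmx_mul trmxK psdL.1 mulmxA.
have -> : qform M ((g_eff L Va Vb)^-1 *: y)
    = qform L (Pab R Va Vb *m ((g_eff L Va Vb)^-1 *: y)).
  by rewrite /qform trmx_mul !mulmxA.
rewrite -scalemxAr Pab_mul_potential qformZ -g_eff_energy.
by rewrite expr2 mulrVK ?mulfVK // unitfE.
Qed.

End Potential.

(** * The Laplacian *)

Lemma laplacian_mul1 (R : realFieldType) (n : nat) (G : signed_graph R n) :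
  laplacian G *m (const_mx 1 : 'cV_n) = 0.
Proof.
rewrite /laplacian -mulmxA [X in _ *m X](_ : _ = 0) ?mulmx0 //.
apply/colP=> k; rewrite !mxE.
under eq_bigr do rewrite !mxE mulr1.
rewrite sumrB.
have one (j : 'I_n) : \sum_i (i == j)%:R = 1 :> R.
  by rewrite (bigD1 j) //= eqxx big1 ?addr0 // => i /negPf ->.
by rewrite !one subrr.
Qed.

Theorem theorem2 (R : realType) (n : nat) (G : signed_graph R n)
    (Va Vb : {set 'I_n}) :
  graph_connected G ->
  Va != finset.set0 -> Vb != finset.set0 -> [disjoint Va & Vb] ->
  psdmx (laplacian G) -> simple_eigenvalue (laplacian G) 0 ->
  [/\ (0 < r_eff (laplacian G) Va Vb)%E,
      is_minimum
        [set (qform (mpinv (laplacian G)) x)%:E | x in feasible Va Vb]%classic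
        (r_eff (laplacian G) Va Vb)
    & r_eff (laplacian G) Va Vb =
      (qform (mpinv ((Pab R Va Vb)^T *m laplacian G *m Pab R Va Vb))
             (e1_sub_e2 R #|~: (Va :|: Vb)|))%:E].
Proof.
move=> _ a0 b0 dab psdL sL; set L := laplacian G in psdL sL *.
have /set0Pn[i0 _] := a0.
have L1 : L *m (const_mx 1 : 'cV_n) = 0 := laplacian_mul1 G.
have one0 : (const_mx 1 : 'cV[R]_n) != 0.
  by apply/eqP => /colP/(_ i0); rewrite !mxE => /eqP; rewrite oner_eq0.
have kerL (v : 'cV_n) : L *m v = 0 -> exists c, v = c *: const_mx 1.
  exact: (simple_eigenvalue0_kernel sL psdL.1 one0 L1).
have g0 : 0 < g_eff L Va Vb by apply: g_eff_gt0.
have rE : r_eff L Va Vb = ((g_eff L Va Vb)^-1)%:E.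
  by rewrite /r_eff gt_eqF.
split.
- by rewrite rE lte_fin invr_gt0.
- rewrite rE; split=> [|_ [x fx <-]].
    exists ((g_eff L Va Vb)^-1 *: (L *m potential L Va Vb)).
      exact: feasible_current.
    by rewrite qform_mpinv_current.
  by rewrite lee_fin qform_mpinv_feasible_ge.
by rewrite rE qform_mpinv_Pab.
Qed.
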